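(* Let $V$ be a vertex operator algebra, fix $n\in\mathbb{Z}_+$, and let $u\in V$ have weight $\mathrm{wt}\,u\ge-n$ such that $V^u=\langle u\rangle^1$ satisfies the permutation property. Then $A_n^u$ is generated by the elements \[ u_{-2n}^{i_{2n}}u_{-2n+1}^{i_{2n-1}}\cdots u_{-1}^{i_1}\mathbf{1}+O_n(V)\quad\text{and}\quad u_{-1}^{j}\mathbf{1}+O_n(V), \] where $i_1,\dots,i_{2n}\in\mathbb{N}$ with $-n\le i_1\mathrm{wt}\,u\le n$, and $j\in\mathbb{Z}_+$.
   Context: $V$ has vacuum $\mathbf{1}$, modes $Y(v,x)=\sum v_kx^{-k-1}$, Virasoro operators $L(m)$, weights $\mathrm{wt}$. For homogeneous $a$: $a\circ_nb=\mathrm{Res}_x(1+x)^{\mathrm{wt}\,a+n}Y(a,x)b\,x^{-2n-2}$; $O_n(V)=\{(L(-1)+L(0))v:v\in V\}+\mathrm{span}\{a\circ_nb\}$; $A_n(V)=V/O_n(V)$ with product $a*_nb=\sum_{m=0}^n(-1)^m\binom{m+n}{n}\mathrm{Res}_x(1+x)^{\mathrm{wt}\,a+n}Y(a,x)b\,x^{-n-m-1}$. $V^u=\langle u\rangle^1$ is the span of all $u_{-k_1}\cdots u_{-k_r}\mathbf{1}$ ($k_i\in\mathbb{Z}_+$), assumed a vertex subalgebra; $F_r(w)$ is the span of $u_{-k_1}\cdots u_{-k_p}w$ with $p\le r$, $k_i\ge1$. Permutation property: for all $m\in\mathbb{Z}_+$, permutations $\sigma$, $u^{(i)},w\in V^u$,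 $k_i\in\mathbb{Z}$: $u^{(1)}_{-k_1}\cdots u^{(m)}_{-k_m}w-u^{(\sigma(1))}_{-k_{\sigma(1)}}\cdots u^{(\sigma(m))}_{-k_{\sigma(m)}}w\in F_{m-1}(w)$. $A_n^u$ is the subalgebra of $A_n(V)$ generated by $\{a+O_n(V):a\in V^u\}$. *)

(* Defs.v *)
From HB Require Import structures.
From mathcomp Require Import all_boot all_order all_algebra all_fingroup.
Set Implicit Arguments. Unset Strict Implicit. Unset Printing Implicit Defensive.
Import Order.TTheory GRing.Theory Num.Theory.
Local Open Scope ring_scope.

Definition binz (K : fieldType) (p : int) (i : nat) : K :=
  (\prod_(k < i) (p%:~R - k%:R)) / (i`!)%:R.

Inductive span_of (K : fieldType) (V : lmodType K) (P : V -> Prop) : V -> Prop :=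
| sp_gen x : P x -> span_of P x
| sp_0 : span_of P 0
| sp_add x y : span_of P x -> span_of P y -> span_of P (x + y)
| sp_scale (a : K) x : span_of P x -> span_of P (a *: x).

(* Y (a) n b  is the mode  a_n b ;  L(m) = omega_{m+1} *)
Definition is_VOA (K : fieldType) (V : lmodType K) (Y : V -> int -> V -> V)
    (one om : V) (c : K) : Prop :=
  let L := fun (m : int) (v : V) => Y om (m + 1) v in
      (forall n (x y w : V) (a : K), Y (a *: x + y) n w = a *: Y x n w + Y y n w) /\
      (forall n (x y w : V) (a : K), Y w n (a *: x + y) = a *: Y w n x + Y w n y) /\
      (forall a b : V, exists N : int, forall n, N <= n -> Y a n b = 0) /\
      (forall n (w : V), Y one n w = if n == -1 then w else 0) /\
      (forall (a : V) n, 0 <= n -> Y a n one = 0) /\ (forall a : V, Y a (-1) one = a) /\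
      (* Jacobi (Borcherds) identity in components; all sums are finite by
         truncation and are taken over i < N for any N past which all terms vanish *)
      (forall (a b w : V) (m n p : int) (N : nat),
          (forall i : nat, (N <= i)%N ->
             [/\ Y a (p + i%:Z) b = 0, Y b (n + i%:Z) w = 0 & Y a (m + i%:Z) w = 0]) ->
          \sum_(i < N) binz K m i *: Y (Y a (p + i%:Z) b) (m + n - i%:Z) w =
          \sum_(i < N) ((-1) ^+ i * binz K p i) *:
              (Y a (p + m - i%:Z) (Y b (n + i%:Z) w)
               - (-1) ^ p *: Y b (p + n - i%:Z) (Y a (m + i%:Z) w))) /\
      (forall (m k : int) (w : V),
          L m (L k w) - L k (L m w) =
          (m - k)%:~R *: L (m + k) w
          + (if m + k == 0 then ((m ^+ 3 - m)%:~R / 12%:R * c) *: w else 0)) /\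
      (* L(-1)-derivative property:  Y(L(-1)a, x) = d/dx Y(a, x) *)
      (forall (a w : V) (n : int), Y (L (-1) a) n w = - (n%:~R) *: Y a (n - 1) w) /\
      (L 0 om = 2%:R *: om) /\
          (forall v : V, exists (I : nat) (ks : 'I_I -> int) (vs : 'I_I -> V),
              v = \sum_(i < I) vs i /\ forall i, L 0 (vs i) = (ks i)%:~R *: vs i) /\
          (exists N : int, forall (k : int) (v : V), k < N -> L 0 v = k%:~R *: v -> v = 0) /\
          (forall k : int, exists s : seq V, forall v : V, L 0 v = k%:~R *: v ->
              exists cs : nat -> K, v = \sum_(i < size s) cs i *: s`_i).

Record VOA (K : fieldType) := {
  vspace_of :> lmodType K;
  vY : vspace_of -> int -> vspace_of -> vspace_of;
  vone : vspace_of;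
  vomega : vspace_of;
  vcharge : K;
  vax : is_VOA vY vone vomega vcharge }.

Section VOAdefs.
Variables (K : fieldType) (V : VOA K).
Local Notation Y := (@vY K V).
Definition Lop (m : int) (v : V) : V := Y (vomega V) (m + 1) v.

Definition homog (k : int) (a : V) : Prop := Lop 0 a = k%:~R *: a.

Definition resum (f : nat -> V) (c : V) : Prop :=
  exists N, forall M, (N <= M)%N -> c = \sum_(i < M) f i.

Definition Ogen (n : nat) (c : V) : Prop :=
  (exists v : V, c = Lop (-1) v + Lop 0 v) \/
  (exists (a b : V) (k : int), homog k a /\
     (* a o_n b = Res_x (1+x)^{wt a + n} Y(a,x) b x^{-2n-2} *)
     resum (fun i => binz K (k + n%:Z) i *: Y a (i%:Z - 2 * n%:Z - 2) b) c).

Definition On (n : nat) : V -> Prop := span_of (Ogen n).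

Definition star_hom (n : nat) (a b c : V) : Prop :=
  exists k : int, homog k a /\
    resum (fun i => \sum_(m < n.+1)
             ((-1) ^+ m * ('C(m + n, n))%:R * binz K (k + n%:Z) i) *:
               Y a (i%:Z - n%:Z - m%:Z - 1) b) c.

Definition star (n : nat) (a b c : V) : Prop :=
  exists (I : nat) (as_ cs : 'I_I -> V),
    [/\ a = \sum_(i < I) as_ i, c = \sum_(i < I) cs i &
        forall i, star_hom n (as_ i) b (cs i)].

(* preimage in V of the subalgebra of A_n(V) = V/O_n(V) generated by the
   classes of the elements satisfying S *)
Inductive genA (n : nat) (S : V -> Prop) : V -> Prop :=
| gA_gen x : S x -> genA n S x
| gA_0 : genA n S 0
| gA_add x y : genA n S x -> genA n S y -> genA n S (x + y)
| gA_scale (a : K) x : genA n S x -> genA n S (a *: x)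
| gA_mul x y z : genA n S x -> genA n S y -> star n x y z -> genA n S z
| gA_mod x y : genA n S x -> On n (y - x) -> genA n S y.

Definition uword (u : V) (ks : seq nat) (w : V) : V :=
  foldr (fun k x => Y u (- k%:Z) x) w ks.

Definition Vu (u : V) : V -> Prop :=
  span_of (fun x => exists ks : seq nat, all (fun k => 0 < k)%N ks /\
                                         x = uword u ks (vone V)).

Definition Fspan (u : V) (r : nat) (w : V) : V -> Prop :=
  span_of (fun x => exists ks : seq nat,
     [/\ (size ks <= r)%N, all (fun k => 0 < k)%N ks & x = uword u ks w]).

Definition gword (l : seq (V * int)) (w : V) : V :=
  foldr (fun p x => Y p.1 (- p.2) x) w l.

Definition permutation_property (u : V) : Prop :=
  forall (m : nat) (s : 'S_m) (us : 'I_m -> V) (ks : 'I_m -> int) (w : V),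
    (0 < m)%N -> (forall i, Vu u (us i)) -> Vu u w ->
    Fspan u m.-1 w
      (gword [seq (us i, ks i) | i <- enum 'I_m] w
       - gword [seq (us (s i), ks (s i)) | i <- enum 'I_m] w).

(* u_{-2n}^{i_{2n}} ... u_{-1}^{i_1} 1, with t = [:: i_1; ...; i_{2n}] *)
Definition pword (u : V) (t : seq nat) : V :=
  foldl (fun x (p : nat * nat) => iter p.2 (Y u (- p.1%:Z)) x) (vone V)
        (zip (iota 1 (size t)) t).

End VOAdefs.

(* Main.v *)
(** Induction on the length [r] of words [u_{-k_1} ... u_{-k_r} 1]. By the permutation
    property the letters of such a word commute modulo shorter words, and [u_j],
    [j >= 0], maps a word to words that are no longer.
    - Letters [u_{-k}], [k >= 2n+2], are lowered by [(L(-1)^m u) o_n b], and [u_{-2n-1}]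
      by [u *_n b].
    - When [a] has weight [l], the coefficient of [a_{-1} b] in [a *_n b] is
      [(-1)^n C(l+n,n) C(l-1,n)], which vanishes exactly when [0 < |l| <= n].
    - If [0 < |wt u| <= n], the reduction of [u_{-2n-1}] therefore creates no [u_{-1}];
      if moreover [|s wt u| > n], the product of [u_{-1}^s 1] with a word free of
      [u_{-1}] trades [u_{-1}^s] for words with fewer [u_{-1}].
    - If [wt u > n], the reduction of [u_{-2n-1}] does create [u_{-1}], so applying
      [L(-1) + L(0)] to a word in which one [u_{-1}] was replaced by [u_{-2n}]
      recovers that [u_{-1}] up to words with fewer [u_{-1}]. *)
Require Import Defs.
From HB Require Import structures.
From mathcomp Require Import all_boot all_order all_algebra all_fingroup.
From mathcomp Require Import zify ring.
Import Order.TTheory GRing.Theory Num.Theory.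
Local Open Scope ring_scope.
Set Implicit Arguments. Unset Strict Implicit. Unset Printing Implicit Defensive.

(** * Generalized binomial coefficients in characteristic zero *)

Section Binomials.
Variables (K : fieldType) (hK : [pchar K] =i pred0).

Lemma natr_neq0 k : (0 < k)%N -> k%:R != 0 :> K.
Proof. by move=> k0; rewrite ((pcharf0P K).1 hK) // -lt0n. Qed.

Lemma intr_eq0_char0 (z : int) : (z%:~R == 0 :> K) = (z == 0).
Proof.
case: z => k; first by rewrite -pmulrn ((pcharf0P K).1 hK).
by rewrite NegzE mulrNz oppr_eq0 -pmulrn ((pcharf0P K).1 hK).
Qed.

Lemma binz0 (p : int) : binz K p 0 = 1.
Proof. by rewrite /binz big_ord0 fact0 divr1. Qed.

(** In characteristic zero the factorial is invertible, so the quotient vanishes only through a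
    factor [p - k] with [k < i]. *)
Lemma binz_eq0 (p : int) i : (binz K p i == 0) = (0 <= p < i%:Z).
Proof.
rewrite /binz mulf_eq0 invr_eq0 (negPf (natr_neq0 (fact_gt0 i))) orbF.
apply/idP/idP.
  move/prodf_eq0 => [k _]; rewrite pmulrn -intrB intr_eq0_char0 subr_eq0 => /eqP ->.
  by rewrite lez_nat ltz_nat ltn_ord.
case: p => // p /andP [_]; rewrite ltz_nat => hp.
by apply/prodf_eq0; exists (Ordinal hp) => //=; rewrite -pmulrn subrr.
Qed.

Lemma binz_pascal (p : int) i :
  binz K (p + 1) i.+1 = binz K p i.+1 + binz K p i.
Proof.
rewrite /binz big_ord_recl big_ord_recr /= factS natrM subr0.
rewrite (eq_bigr (fun k : 'I_i => p%:~R - k%:R)); last first.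
  by move=> k _; rewrite /bump /= intrD mulrS addrKA.
have h1 := natr_neq0 (fact_gt0 i); have h2 := @natr_neq0 i.+1 isT.
set P := \prod_(_ < _) _; rewrite intrD -[1%:~R]/1.
by rewrite mulrS in h2 *; field; rewrite h1.
Qed.

Lemma binz_zero_l i : binz K 0 i = (i == 0%N)%:R.
Proof.
case: i => [|i]; first by rewrite binz0.
by rewrite /binz big_ord_recl subrr mul0r mul0r.
Qed.

Lemma binz_minus1 i : binz K (-1) i = (-1) ^+ i.
Proof.
elim: i => [|i IH]; first by rewrite binz0.
have := binz_pascal (-1) i; rewrite addNr binz_zero_l IH => /esym/eqP.
by rewrite addr_eq0 => /eqP ->; rewrite exprS mulN1r.
Qed.

Lemma binz_alternating_sum (p : int) n :
  \sum_(m < n.+1) (-1) ^+ m * binz K p m = (-1) ^+ n * binz K (p - 1) n.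
Proof.
elim: n => [|n IH]; first by rewrite big_ord1 !binz0.
by rewrite big_ord_recr IH /= -{2}[p](subrK 1) binz_pascal exprS; ring.
Qed.

(** Both sides equal [p (p-1) ... (p-n-m+1)] divided by [n! m!]. *)
Lemma binz_add (p : int) n m :
  'C(m + n, n)%:R * binz K p (n + m) = binz K p n * binz K (p - n%:Z) m.
Proof.
have h : ('C(m + n, n) * (n`! * m`!) = (n + m)`!)%N.
  by rewrite -{2}[m](addnK n) bin_fact ?leq_addl // addnC.
rewrite /binz big_split_ord /= -h !natrM.
rewrite [in RHS](eq_bigr (fun k : 'I_m => p%:~R - (n + k)%:R)); last first.
  by move=> k _; rewrite intrB natrD opprD addrA.
have h1 := natr_neq0 (fact_gt0 n); have h2 := natr_neq0 (fact_gt0 m).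
have h3 : 'C(m + n, n)%:R != 0 :> K by rewrite natr_neq0 // bin_gt0 leq_addl.
by field; rewrite h1 h2 h3.
Qed.

(* The coefficient of [a_{-j} b] in [a *_n b] when [a] has weight [l]. *)
Definition star_coef (n : nat) (l : int) (j : nat) : K :=
  \sum_(m < n.+1 | (j <= n + m + 1)%N)
    (-1) ^+ m * 'C(m + n, n)%:R * binz K (l + n%:Z) (n + m + 1 - j).

(** Only [m = n] contributes, and its term is the central binomial coefficient up to sign. *)
Lemma star_coef_top n l : star_coef n l (2 * n).+1 != 0.
Proof.
rewrite /star_coef (big_pred1 ord_max) => [|m]; last first.
  apply/idP/eqP => [h|->]; last by rewrite /=; lia.
  by apply/val_inj; move: h (ltn_ord m) => /=; lia.
have -> : (n + (ord_max : 'I_n.+1) + 1 - (2 * n).+1 = 0)%N by rewrite /=; lia.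
rewrite binz0 mulr1 mulf_neq0 ?signr_eq0 ?natr_neq0 //.
by rewrite bin_gt0 leq_addl.
Qed.

(** By [binz_add] the factor [binz K (l + n) n] comes out of the sum, leaving an alternating sum of
    the [binz K l m], which has a closed form. *)
Lemma star_coef1 n l :
  star_coef n l 1 = binz K (l + n%:Z) n * ((-1) ^+ n * binz K (l - 1) n).
Proof.
rewrite -binz_alternating_sum mulr_sumr /star_coef; apply: eq_big => [m|m _].
  by rewrite addn1.
by rewrite addn1 subn1 -mulrA binz_add addrK mulrCA.
Qed.

(** The first factor vanishes for [-n <= l < 0], the second for [0 < l <= n]. *)
Lemma star_coef1_eq0 n l : (star_coef n l 1 == 0) = (0 < `|l|%N <= n)%N.
Proof.
rewrite star_coef1 mulf_eq0 binz_eq0 mulf_eq0 signr_eq0 binz_eq0 /=.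
by apply/idP/idP; lia.
Qed.
End Binomials.

(** * Mode calculus in a vertex operator algebra *)

Section Modes.
Variables (K : fieldType) (V : VOA K).
Local Notation Y := (@vY K V).
Local Notation one := (vone V).

Lemma vY_lin_l n (x y w : V) (a : K) :
  Y (a *: x + y) n w = a *: Y x n w + Y y n w.
Proof. by case: (vax V) => h _; apply: h. Qed.

Lemma vY_lin_r n (x y w : V) (a : K) :
  Y w n (a *: x + y) = a *: Y w n x + Y w n y.
Proof. by case: (vax V) => _ [h _]; apply: h. Qed.

Lemma vY_trunc (a b : V) : exists N : nat, forall i : int, N%:Z <= i -> Y a i b = 0.
Proof.
case: (vax V) => _ [_ [h _]]; have [N hN] := h a b; exists `|N|%N => i hi.
by apply: hN; lia.
Qed.

Lemma vY_one n (w : V) : Y one n w = if n == -1 then w else 0.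
Proof. by case: (vax V) => _ [_ [_ [h _]]]; apply: h. Qed.

Lemma vY_annihil_one (a : V) n : 0 <= n -> Y a n one = 0.
Proof. by case: (vax V) => _ [_ [_ [_ [h _]]]]; apply: h. Qed.

Lemma vY_creation (a : V) : Y a (-1) one = a.
Proof. by case: (vax V) => _ [_ [_ [_ [_ [h _]]]]]; apply: h. Qed.

Lemma borcherds (a b w : V) (m n p : int) (N : nat) :
  (forall i : nat, (N <= i)%N ->
     [/\ Y a (p + i%:Z) b = 0, Y b (n + i%:Z) w = 0 & Y a (m + i%:Z) w = 0]) ->
  \sum_(i < N) binz K m i *: Y (Y a (p + i%:Z) b) (m + n - i%:Z) w =
  \sum_(i < N) ((-1) ^+ i * binz K p i) *:
      (Y a (p + m - i%:Z) (Y b (n + i%:Z) w)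
       - (-1) ^ p *: Y b (p + n - i%:Z) (Y a (m + i%:Z) w)).
Proof. by case: (vax V) => _ [_ [_ [_ [_ [_ [h _]]]]]]; apply: h. Qed.

Lemma virasoro (m k : int) (w : V) :
  Lop m (Lop k w) - Lop k (Lop m w) =
  (m - k)%:~R *: Lop (m + k) w
  + (if m + k == 0 then ((m ^+ 3 - m)%:~R / 12%:R * vcharge V) *: w else 0).
Proof. by case: (vax V) => _ [_ [_ [_ [_ [_ [_ [h _]]]]]]]; apply: h. Qed.

Lemma vY_derivative (a w : V) (n : int) :
  Y (Lop (-1) a) n w = - (n%:~R) *: Y a (n - 1) w.
Proof. by case: (vax V) => _ [_ [_ [_ [_ [_ [_ [_ [h _]]]]]]]]; apply: h. Qed.

Lemma vYr0 (a : V) n : Y a n 0 = 0.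
Proof. by have := vY_lin_r n 0 0 a (-1); rewrite scaler0 addr0 scaleN1r addNr. Qed.

Lemma vYrD (a x y : V) n : Y a n (x + y) = Y a n x + Y a n y.
Proof. by rewrite -[x]scale1r vY_lin_r !scale1r. Qed.

Lemma vYrZ (a x : V) (c : K) n : Y a n (c *: x) = c *: Y a n x.
Proof. by rewrite -[c *: x]addr0 vY_lin_r vYr0 addr0. Qed.

Lemma vYrB (a x y : V) n : Y a n (x - y) = Y a n x - Y a n y.
Proof. by rewrite -scaleN1r vYrD vYrZ scaleN1r. Qed.

Lemma vYl0 (b : V) n : Y 0 n b = 0.
Proof. by have := vY_lin_l n 0 0 b (-1); rewrite scaler0 addr0 scaleN1r addNr. Qed.

Lemma vYlZ (a x : V) (c : K) n : Y (c *: x) n a = c *: Y x n a.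
Proof. by rewrite -[c *: x]addr0 vY_lin_l vYl0 addr0. Qed.

Lemma vYr_sum (a : V) n (I : finType) (F : I -> V) :
  Y a n (\sum_i F i) = \sum_i Y a n (F i).
Proof. by apply: (big_morph (Y a n)); [move=> x y; apply: vYrD | apply: vYr0]. Qed.

Lemma vY_bound (a b w : V) (p m n : int) : exists N : nat, forall i : nat,
  (N <= i)%N ->
  [/\ Y a (p + i%:Z) b = 0, Y b (n + i%:Z) w = 0 & Y a (m + i%:Z) w = 0].
Proof.
have [N1 h1] := vY_trunc a b; have [N2 h2] := vY_trunc b w.
have [N3 h3] := vY_trunc a w.
exists (N1 + N2 + N3 + `|p| + `|n| + `|m|)%N => i hi.
by split; [apply: h1 | apply: h2 | apply: h3]; lia.
Qed.

(** The Borcherds identity at [m = 0], [p = -1]: the left side keeps only [i = 0], and the signs on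
    the right cancel against [binz K (-1) i]. *)
Lemma vY_normal_product (hK : [pchar K] =i pred0) (a b w : V) (n : int) :
  exists N0 : nat, forall N, (N0 <= N)%N ->
  Y (Y a (-1) b) n w =
  \sum_(i < N) (Y a (-1 - i%:Z) (Y b (n + i%:Z) w) + Y b (n - 1 - i%:Z) (Y a i%:Z w)).
Proof.
have [N0 hN0] := vY_bound a b w (-1) 0 n; exists N0.+1 => -[//|N] hN.
have := @borcherds a b w 0 n (-1) N.+1 (fun i hi => hN0 i (leq_trans (ltnW hN) hi)).
rewrite big_ord_recl big1 => [|i _]; last by rewrite binz_zero_l /= scale0r.
rewrite /= binz0 scale1r !addr0 add0r => ->.
apply: eq_bigr => i _; rewrite binz_minus1 // -exprMn mulrNN mulr1 expr1n.
rewrite scale1r add0r -[(-1) ^ (-1)]/((-1 : K)^-1) invrN1 scaleN1r opprK.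
by rewrite [-1 + n]addrC.
Qed.

(** At [p = 0] the Borcherds identity is the commutator formula; [m = 0] selects the mode of
    [vomega V] that is [L(-1)]. *)
Lemma Lm1_mode (a w : V) (n : int) :
  Lop (-1) (Y a n w) = Y a n (Lop (-1) w) - n%:~R *: Y a (n - 1) w.
Proof.
have [N0 hN0] := vY_bound (vomega V) a w 0 0 n.
have := @borcherds (vomega V) a w 0 n 0 N0.+1 (fun i hi => hN0 i (ltnW hi)).
rewrite !big_ord_recl !big1 => [|i _|i _];
  try by rewrite binz_zero_l ?mulr0 scale0r.
rewrite !binz0 expr0 mul1r !scale1r !addr0 !add0r ?subr0 ?scale1r.
have -> : Y (vomega V) 0 a = Lop (-1) a by rewrite /Lop addNr.
rewrite vY_derivative => /esym/eqP; rewrite subr_eq /Lop addNr => /eqP ->.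
by rewrite scaleNr addrC.
Qed.

(** The commutator formula at [m = 1]: the two surviving terms involve [L(-1) a] and [L(0) a], and
    the derivative property turns the first into a multiple of [Y a n w]. *)
Lemma L0_mode (a w : V) (n : int) :
  Lop 0 (Y a n w) = Y a n (Lop 0 w) + Y (Lop 0 a) n w - (n + 1)%:~R *: Y a n w.
Proof.
have [N0 hN0] := vY_bound (vomega V) a w 0 1 n.
have := @borcherds (vomega V) a w 1 n 0 N0.+2 (fun i hi => hN0 i (ltnW (ltnW hi))).
rewrite ![in RHS]big_ord_recl [in RHS]big1 => [|i _];
  last by rewrite binz_zero_l mulr0 scale0r.
rewrite 2!big_ord_recl big1 => [|i _]; last first.
  rewrite /binz 2!big_ord_recl /= /bump /= -[1%:~R]/(1%:R) subrr mul0r mulr0 mul0r.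
  by rewrite scale0r.
rewrite !binz0 binz_zero_l /= mulr0 scale0r expr0 mul1r !scale1r !addr0 !add0r ?subr0 ?scale1r.
have -> : binz K 1 1 = 1 by rewrite /binz big_ord1 subr0 divr1.
have -> : Y (vomega V) 0 a = Lop (-1) a by rewrite /Lop addNr.
rewrite -[Y (vomega V) 1 a]/(Lop 0 a) -![Y (vomega V) 1 _]/(Lop 0 _) scale1r.
rewrite vY_derivative => /esym/eqP; rewrite subr_eq => /eqP ->.
rewrite [1 + n]addrC [n + 1 - (bump 0 0)%:Z]addrK scaleNr.
by rewrite [LHS]addrC [X in _ + X = _]addrC addrA.
Qed.

Lemma homog_one : homog 0 one.
Proof. by rewrite /homog /Lop vY_annihil_one // scale0r. Qed.

Lemma Lm1_one : Lop (-1) one = 0.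
Proof. by rewrite /Lop vY_annihil_one. Qed.

Lemma homog_mode k l (a b : V) (n : int) :
  homog k a -> homog l b -> homog (k + l - n - 1) (Y a n b).
Proof.
rewrite /homog L0_mode => -> ->; rewrite vYrZ vYlZ -scalerDl -scalerBl.
by congr (_ *: _); rewrite !(intrD, intrN); ring.
Qed.

Lemma homog_Lm1 k (a : V) : homog k a -> homog (k + 1) (Lop (-1) a).
Proof.
move=> ha; have := virasoro 0 (-1) a; rewrite /= addr0 opprK !add0r => /eqP.
rewrite subr_eq => /eqP; rewrite /homog => ->; rewrite ha.
rewrite {2}/Lop vYrZ -[Y _ _ _]/(Lop (-1) a).
by rewrite -scalerDl -intrD addrC.
Qed.

Lemma homog_iter_Lm1 k m (a : V) : homog k a -> homog (k + m%:Z) (iter m (Lop (-1)) a).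
Proof.
move=> ha; elim: m => [|m IH]; first by rewrite addr0.
by rewrite -addn1 PoszD addrA addn1 /=; apply: homog_Lm1.
Qed.

Lemma iter_Lm1_mode m (a b : V) (j : int) :
  Y (iter m (Lop (-1)) a) j b =
  ((-1) ^+ m * \prod_(t < m) (j - t%:Z)%:~R) *: Y a (j - m%:Z) b.
Proof.
elim: m j => [|m IH] j; first by rewrite big_ord0 mulr1 scale1r subr0.
rewrite /= vY_derivative IH scalerA big_ord_recl subr0 /=.
congr (_ *: Y a _ b); last by rewrite intS opprD addrA.
rewrite exprS [in RHS](eq_bigr (fun t : 'I_m => (j - 1 - t%:Z)%:~R)).
  by set P := \prod_(_ < _) _; ring.
by move=> t _; rewrite /bump /= intS opprD addrA.
Qed.
End Modes.

(** * Subspaces as closed predicates *)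

Section Subspaces.
Variables (K : fieldType) (V : lmodType K).

Definition subspace (T : V -> Prop) :=
  [/\ T 0, forall x y, T x -> T y -> T (x + y) & forall (a : K) x, T x -> T (a *: x)].

Lemma subspace_span (P : V -> Prop) : subspace (span_of P).
Proof. by split; [apply: sp_0 | apply: sp_add | apply: sp_scale]. Qed.

Lemma span_min (P T : V -> Prop) :
  subspace T -> (forall x, P x -> T x) -> forall x, span_of P x -> T x.
Proof.
by case=> h0 hD hZ hP x; elim=> *; [apply: hP | apply: h0 | apply: hD | apply: hZ].
Qed.

Lemma subspace_preim (T : V -> Prop) (f : V -> V) :
  (forall a x y, f (a *: x + y) = a *: f x + f y) -> subspace T ->
  subspace (fun x => T (f x)).
Proof.
move=> hf [h0 hD hZ].
have f0 : f 0 = 0 by have := hf (-1) 0 0; rewrite scaler0 addr0 scaleN1r addNr.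
split=> [|x y hx hy|a x hx]; first by rewrite f0.
  by rewrite -[x]scale1r hf scale1r; apply: hD.
by rewrite -[a *: x]addr0 hf f0 addr0; apply: hZ.
Qed.

Section Closure.
Variables (T : V -> Prop) (hT : subspace T).

Lemma subspace0 : T 0. Proof. by case: hT. Qed.

Lemma subspaceD x y : T x -> T y -> T (x + y).
Proof. by case: hT => _ h _; apply: h. Qed.

Lemma subspaceZ a x : T x -> T (a *: x).
Proof. by case: hT => _ _; apply. Qed.

Lemma subspaceB x y : T x -> T y -> T (x - y).
Proof. by move=> hx hy; apply: subspaceD => //; rewrite -scaleN1r; apply: subspaceZ. Qed.

Lemma subspaceBr x y : T (x - y) -> T y -> T x.
Proof. by move=> h1 h2; rewrite -[x](subrK y); apply: subspaceD. Qed.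

Lemma subspaceBl x y : T (x - y) -> T x -> T y.
Proof. by move=> h1 h2; rewrite -[y](subKr x); apply: subspaceB. Qed.

Lemma subspace_scale_inv a x : a != 0 -> T (a *: x) -> T x.
Proof. by move=> ha h; rewrite -[x](scalerK ha); apply: subspaceZ. Qed.

Lemma subspace_sum (I : Type) (r : seq I) (P : pred I) (F : I -> V) :
  (forall i, P i -> T (F i)) -> T (\sum_(i <- r | P i) F i).
Proof.
by move=> h; apply: big_ind => //; [apply: subspace0 | apply: subspaceD].
Qed.

Lemma subspace_sum_nat m p (F : nat -> V) :
  (forall i, (m <= i < p)%N -> T (F i)) -> T (\sum_(m <= i < p) F i).
Proof.
by move=> h; rewrite big_nat_cond; apply: subspace_sum => i; rewrite andbT; apply: h.
Qed.
End Closure.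
End Subspaces.

Lemma subspace_mode (K : fieldType) (V : VOA K) (T : V -> Prop) (a : V) n :
  subspace T -> subspace (fun x => T (vY a n x)).
Proof. by move=> hT; apply: (subspace_preim _ hT) => c x y; apply: vY_lin_r. Qed.

(** * The filtration of words in the modes of [u] by length *)

Section Filtration.
Variables (K : fieldType) (hK : [pchar K] =i pred0) (V : VOA K) (u : V).
Hypothesis hperm : permutation_property u.
Local Notation Y := (@vY K V).
Local Notation one := (vone V).
Local Notation F r := (Fspan u r one).

Lemma subspace_F r : subspace (F r). Proof. exact: subspace_span. Qed.

Lemma word_in_F r ks :
  (size ks <= r)%N -> all (fun k => 0 < k)%N ks -> F r (uword u ks one).
Proof. by move=> h1 h2; apply: sp_gen; exists ks. Qed.

Lemma F_mono r r' x : (r <= r')%N -> F r x -> F r' x.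
Proof.
move=> le; apply: span_min; first exact: subspace_F.
by move=> _ [ks [h1 h2 ->]]; apply: word_in_F => //; apply: leq_trans le.
Qed.

Lemma F_lift r k x : (0 < k)%N -> F r x -> F r.+1 (Y u (- k%:Z) x).
Proof.
move=> hk; apply: (@span_min _ _ _ (fun x => F r.+1 (Y u (- k%:Z) x))).
  exact: (subspace_mode _ _ (subspace_F _)).
move=> _ [ks [h1 h2 ->]]; apply: (@word_in_F _ (k :: ks)) => //=.
by rewrite hk.
Qed.

Lemma Vu_one : Vu u one.
Proof. by apply: sp_gen; exists [::]. Qed.

Lemma Vu_gen : Vu u u.
Proof. by apply: sp_gen; exists [:: 1%N]; split=> //=; rewrite vY_creation. Qed.

(** The permutation property with every vector equal to [u]. The modes are arbitrary integers, so
    nonnegative ones can be moved too. *)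
Lemma gword_perm (l l' : seq int) :
  perm_eq l l' -> (0 < size l)%N ->
  F (size l).-1 (gword [seq (u, k) | k <- l] one - gword [seq (u, k) | k <- l'] one).
Proof.
move=> hl l0.
have /tuple_permP [s hs] : perm_eq l' (in_tuple l) by rewrite perm_sym.
have := @hperm (size l) s (fun=> u) (tnth (in_tuple l)) one l0 (fun=> Vu_gen) Vu_one.
have -> : [seq (u, tnth (in_tuple l) i) | i <- enum 'I_(size l)] = [seq (u, k) | k <- l].
  rewrite (map_comp (fun k => (u, k))).
  by rewrite (map_tnth_enum (in_tuple l)).
have -> // : [seq (u, tnth (in_tuple l) (s i)) | i <- enum 'I_(size l)]
  = [seq (u, k) | k <- l'].
by rewrite (map_comp (fun k => (u, k))) hs.
Qed.

Lemma uword_gword ks :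
  uword u ks one = gword [seq (u, k) | k <- [seq k%:Z | k <- ks]] one.
Proof. by elim: ks => //= k ks ->. Qed.

Lemma uword_perm ks ks' : perm_eq ks ks' -> (0 < size ks)%N ->
  F (size ks).-1 (uword u ks one - uword u ks' one).
Proof.
move=> h h0; rewrite !uword_gword -(size_map Posz ks).
by apply: gword_perm; rewrite ?size_map //; apply: perm_map.
Qed.

(** Moved to the right end of the word, [u_j] kills the vacuum. The move concerns one letter more
    than the word has, so its error is no longer than the word. *)
Lemma F_nonneg_mode r (j : int) x : 0 <= j -> F r x -> F r (Y u j x).
Proof.
move=> hj; apply: (@span_min _ _ _ (fun x => F r (Y u j x))).
  exact: (subspace_mode _ _ (subspace_F _)).
move=> _ [ks [h1 h2 ->]]; apply: (F_mono h1); rewrite uword_gword.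
have := @gword_perm (- j :: map Posz ks) (rcons (map Posz ks) (- j)).
rewrite perm_sym perm_rcons /= size_map opprK => /(_ (perm_refl _) isT).
rewrite map_rcons -cats1 /gword foldr_cat /= opprK vY_annihil_one //.
suff -> : foldr (fun p x => Y p.1 (- p.2) x) 0 [seq (u, k) | k <- map Posz ks] = 0.
  by rewrite subr0.
by elim: ks {h1 h2} => //= k ks ->; rewrite vYr0.
Qed.

Local Notation pow s := (iter s (Y u (-1)) one).

Lemma pow_mode_F s q (k : int) b : F q b -> F (q + s) (Y (pow s) k b).
Proof.
elim: s q k b => [|s IH] q k b hb.
  by rewrite vY_one addn0; case: ifP => // _; apply: subspace0 (subspace_F _).
have [N /(_ _ (leqnn N)) /= ->] := vY_normal_product hK u (pow s) b k.
apply: (subspace_sum (subspace_F _)) => i _; rewrite addnS.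
apply: (subspaceD (subspace_F _)).
  by rewrite -opprD -[1 + _]intS; apply: F_lift => //; apply: IH.
by apply: F_mono (leqnSn _) _; apply: IH; apply: F_nonneg_mode.
Qed.

(** In the normal product expansion each term contains a nonnegative mode: either that of the
    smaller power, which loses a letter by induction, or a mode [u_i], which adds none. *)
Lemma pow_nonneg_mode_F s q (k : int) b :
  0 <= k -> F q b -> F (q + s).-1 (Y (pow s) k b).
Proof.
elim: s q k b => [|s IH] q k b hk hb.
  by rewrite vY_one ifN; [apply: subspace0 (subspace_F _) | lia].
have [N /(_ _ (leqnn N)) /= ->] := vY_normal_product hK u (pow s) b k.
apply: (subspace_sum (subspace_F _)) => i _; rewrite addnS /=.
apply: (subspaceD (subspace_F _)); last by apply: pow_mode_F; apply: F_nonneg_mode.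
(* The predecessor truncates at 0, so [q + s = 0] is separate; there the power is the vacuum, whose
   only nonzero mode is the one at [-1]. *)
have [qs0|qs0] := posnP (q + s)%N; last first.
  rewrite -opprD -[1 + _]intS -(prednK qs0); apply: F_lift => //.
  by apply: IH => //; lia.
have -> : s = 0%N by lia.
by rewrite vY_one ifN ?vYr0; [apply: subspace0 (subspace_F _) | lia].
Qed.

Lemma lift_pow_nonneg_mode s q (i : nat) (k : int) b :
  0 <= k -> F q b -> F (q + s) (Y u (-1 - i%:Z) (Y (pow s) k b)).
Proof.
move=> hk hb; have [qs0|qs0] := posnP (q + s)%N; last first.
  rewrite -opprD -[1 + _]intS -(prednK qs0); apply: F_lift => //.
  exact: pow_nonneg_mode_F.
have -> : s = 0%N by lia.
by rewrite vY_one ifN ?vYr0; [apply: subspace0 (subspace_F _) | lia].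
Qed.

(* To leading order [Y(u_{-1}^s 1, x)] is the [s]-th power of the creation part
   of [Y(u, x)]. *)
Lemma pow_neg_mode s k ks : all (fun i => 0 < i)%N ks -> (0 < k)%N ->
  span_of (fun x => (0 < s)%N /\ F (size ks + s).-1 x \/ exists v, [/\ size v = s,
       all (fun i => 0 < i)%N v, (sumn v).+1 = (k + s)%N & x = uword u (v ++ ks) one])
    (Y (pow s) (- k%:Z) (uword u ks one)).
Proof.
move=> hks; elim: s k => [|s IH] k k0.
  rewrite vY_one; case: eqP => [hk|_]; last exact: sp_0.
  by apply: sp_gen; right; exists [::]; split=> //=; lia.
have [N /(_ _ (leqnn N)) /= ->] :=
  vY_normal_product hK u (pow s) (uword u ks one) (- k%:Z).
have hT := @subspace_span K V.
apply: (subspace_sum (hT _)) => i _; apply: (subspaceD (hT _)); last first.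
  apply: sp_gen; left; split; rewrite // addnS /=; apply: pow_mode_F; apply: F_nonneg_mode => //.
  exact: word_in_F.
(* For [k <= i] the inner mode is nonnegative and shortens the word. For [i < k] the letter [i + 1]
   is split off and [k - i] remains to be distributed. *)
have [ki|ik] := leqP k i.
  apply: sp_gen; left; split; rewrite // addnS /=.
  by apply: lift_pow_nonneg_mode; [lia | apply: word_in_F].
have -> : - k%:Z + i%:Z = - (k - i)%:Z by lia.
have ki0 : (0 < k - i)%N by lia.
set Q := (X in span_of X _).
apply: (@span_min _ _ _ (fun x => span_of Q (Y u (-1 - i%:Z) x)) _ _ _ (IH _ ki0)) => [|x].
  exact: (subspace_mode _ _ (hT _)).
rewrite -opprD -[1 + _]intS => -[[s0 hx]|[v [h1 h2 h3 ->]]]; apply: sp_gen.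
  left; split; rewrite // addnS /= -(@prednK (size ks + s)); last by lia.
  exact: F_lift.
right; exists (i.+1 :: v); split=> //=; rewrite ?h1 //; lia.
Qed.

Lemma pow_mode1 s ks : all (fun i => 0 < i)%N ks ->
  F (size ks + s).-1
    (Y (pow s) (-1) (uword u ks one) - iter s (Y u (-1)) (uword u ks one)).
Proof.
move=> hks; have hF := subspace_F; elim: s => [|s IH].
  by rewrite vY_one eqxx subrr; apply: subspace0 (hF _).
have [N /(_ _ (leqnSn N)) /= ->] :=
  vY_normal_product hK u (pow s) (uword u ks one) (-1).
rewrite addnS /= (eq_bigr _ (fun i _ => erefl)) big_split /= addrAC.
apply: (subspaceD (hF _)); last first.
  apply: (subspace_sum (hF _)) => i _; apply: pow_mode_F; apply: F_nonneg_mode => //.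
  exact: word_in_F.
(* The term [i = 0] is the leading one; every later term applies a nonnegative mode of the power. *)
rewrite big_ord_recl /= subr0 addrAC -vYrB.
apply: (subspaceD (hF _)); last first.
  apply: (subspace_sum (hF _)) => i _; apply: lift_pow_nonneg_mode => //=.
  exact: word_in_F.
case: s IH => [|s] IH.
  by rewrite vY_one eqxx subrr vYr0; apply: subspace0 (hF _).
by rewrite addnS in IH *; apply: (@F_lift _ 1).
Qed.
End Filtration.

(** * Relations among modes coming from the product and from [O_n(V)] *)

Section Reduction.
Variables (K : fieldType) (hK : [pchar K] =i pred0) (V : VOA K).
Local Notation Y := (@vY K V).
Local Notation one := (vone V).

Lemma resum_exists (f : nat -> V) N :
  (forall i, (N <= i)%N -> f i = 0) -> forall M, (N <= M)%N -> resum f (\sum_(i < M) f i).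
Proof.
move=> h M NM; exists M => M' MM'.
rewrite -!(big_mkord xpredT) (@big_cat_nat _ _ _ M 0 M') //= [X in _ + X]big1_seq ?addr0 //.
by move=> i /andP [_]; rewrite mem_index_iota => /andP [Mi _]; apply/h/(leq_trans NM).
Qed.

(** The terms with [i >= p] are nonnegative modes, which [T] absorbs; the others are reindexed by
    [j = p - i]. *)
Lemma mode_sum_trunc (T : V -> Prop) (a b : V) (g : nat -> K) (p M : nat) :
  subspace T -> (forall j : int, 0 <= j -> T (Y a j b)) -> (p <= M)%N ->
  T (\sum_(i < M) g i *: Y a (i%:Z - p%:Z) b
     - \sum_(1 <= j < p.+1) g (p - j)%N *: Y a (- j%:Z) b).
Proof.
move=> hT h pM.
rewrite -(big_mkord xpredT (fun i => g i *: Y a (i%:Z - p%:Z) b)).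
rewrite (@big_cat_nat _ _ _ p 0 M) //= big_add1 /= big_nat_rev addrAC.
rewrite (eq_big_nat _ _ (F2 := fun i => g (p - i.+1)%N *: Y a (- i.+1%:Z) b)).
  rewrite subrr add0r; apply: (subspace_sum_nat hT) => i /andP [pi _].
  by apply/(subspaceZ hT)/h; lia.
by move=> i /andP [_ ip]; rewrite add0n; congr (_ *: Y a _ b); lia.
Qed.

Variables (n : nat) (S : V -> Prop).
Local Notation G := (genA n S).

Lemma subspace_G : subspace G.
Proof. by split; [apply: gA_0 | apply: gA_add | apply: gA_scale]. Qed.

Lemma On_genA x : On n x -> G x.
Proof. by move=> h; apply: (gA_mod (gA_0 n S)); rewrite subr0. Qed.

Lemma star_reduction (a b : V) (l : int) :
  homog l a -> G a -> G b -> (forall j : int, 0 <= j -> G (Y a j b)) ->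
  G (\sum_(1 <= j < (2 * n).+2) star_coef K n l j *: Y a (- j%:Z) b).
Proof.
move=> ha Ga Gb hpos; have hG := subspace_G; have [N hN] := vY_trunc a b.
pose f i := \sum_(m < n.+1)
  ((-1) ^+ m * ('C(m + n, n))%:R * binz K (l + n%:Z) i) *:
     Y a (i%:Z - n%:Z - m%:Z - 1) b.
pose M := (N + 2 * n + 1)%N.
have hc : resum f (\sum_(i < M) f i).
  apply: (@resum_exists f M) => // i hi; apply: big1 => m _.
  by rewrite hN ?scaler0 //; have := ltn_ord m; lia.
have Gc : G (\sum_(i < M) f i).
  apply: gA_mul Ga Gb _.
  exists 1%N, (fun=> a), (fun=> \sum_(i < M) f i); split; rewrite ?big_ord1 //.
  by exists l.
apply: (subspaceBl hG _ Gc); rewrite exchange_big /=.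
have -> : \sum_(1 <= j < (2 * n).+2) star_coef K n l j *: Y a (- j%:Z) b =
   \sum_(m < n.+1) \sum_(1 <= j < (n + m + 1).+1)
      ((-1) ^+ m * ('C(m + n, n))%:R * binz K (l + n%:Z) (n + m + 1 - j))
        *: Y a (- j%:Z) b.
  under eq_bigr => j _ do rewrite scaler_suml.
  rewrite (exchange_big_dep xpredT) //=; apply: eq_bigr => m _.
  rewrite (@big_nat_widen _ _ _ 1 (n + m + 1).+1 (2 * n).+2) //.
  by have := ltn_ord m; lia.
rewrite -sumrB; apply: (subspace_sum hG) => m _.
have e (i : nat) : i%:Z - n%:Z - m%:Z - 1 = i%:Z - (n + m + 1)%N%:Z by lia.
under eq_bigr => i _ do rewrite e.
apply: (@mode_sum_trunc _ _ _ (fun i => (-1) ^+ m * ('C(m + n, n))%:R * binz K (l + n%:Z) i)) => //.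
by have := ltn_ord m; lia.
Qed.

Lemma circ_reduction (a b : V) (l : int) :
  homog l a -> (forall j : int, 0 <= j -> G (Y a j b)) ->
  G (\sum_(1 <= j < (2 * n).+3) binz K (l + n%:Z) ((2 * n).+2 - j) *: Y a (- j%:Z) b).
Proof.
move=> ha hpos; have hG := subspace_G; have [N hN] := vY_trunc a b.
pose f i := binz K (l + n%:Z) i *: Y a (i%:Z - 2 * n%:Z - 2) b.
pose M := (N + 2 * n + 2)%N.
have hc : resum f (\sum_(i < M) f i).
  apply: (@resum_exists f M) => // i hi.
  by rewrite /f hN ?scaler0 //; lia.
have Gc : G (\sum_(i < M) f i).
  by apply/On_genA/sp_gen; right; exists a, b, l.
apply: (subspaceBl hG _ Gc).
have e (i : nat) : i%:Z - 2 * n%:Z - 2 = i%:Z - (2 * n).+2%:Z by lia.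
under eq_bigr => i _ do rewrite /f e.
by apply: mode_sum_trunc => //; lia.
Qed.

Variables (u : V) (wu : int).
Hypotheses (hn : (0 < n)%N) (hu : homog wu u) (hwu : - (n%:Z) <= wu) (Gu : G u).

(** Solves for the top mode of [u *_n b] if [k = 2n+1], and of [(L(-1)^m u) o_n b] if [k = 2n+2+m].
    The coefficient [alpha] of [u_{-1} b] is kept apart because the weight cases differ in whether
    it vanishes. *)
Lemma mode_reduction k : (2 * n < k)%N ->
  exists d alpha : K, [/\ d != 0, (0 < `|wu| <= n)%N -> alpha = 0,
    k = (2 * n).+1 -> ~~ (0 < `|wu| <= n)%N -> alpha != 0 &
    forall b, G b -> (forall j : int, 0 <= j -> G (Y u j b)) ->
      (forall j, (1 < j < k)%N -> G (Y u (- j%:Z) b)) ->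
      G (d *: Y u (- k%:Z) b + alpha *: Y u (-1) b)].
Proof.
move=> hk; have hG := subspace_G.
have [->|hk'] := eqVneq k (2 * n).+1.
  exists (star_coef K n wu (2 * n).+1), (star_coef K n wu 1); split.
  - exact: star_coef_top.
  - by rewrite -(star_coef1_eq0 hK) => /eqP.
  - by rewrite -(star_coef1_eq0 hK).
  move=> b Gb hpos hmid; have := star_reduction hu Gu Gb hpos.
  rewrite big_nat_recr //= big_ltn; last by lia.
  rewrite addrAC addrC => h; rewrite addrC.
  apply: (subspaceBl hG (x := _ + _) _ h).
  rewrite addrK; apply: (subspace_sum_nat hG) => i hi.
  by apply/(subspaceZ hG)/hmid.
have [m hm] : exists m, k = ((2 * n).+2 + m)%N by exists (k - (2 * n).+2)%N; lia.
(* [X j] is the coefficient of [u_{-j-m} b], the [m] derivatives shifting each mode by [m]. Hence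
   [u_{-1}] can occur only for [m = 0]. *)
pose X j : K := binz K (wu + m%:Z + n%:Z) ((2 * n).+2 - j) *
   ((-1) ^+ m * \prod_(t < m) (- j%:Z - t%:Z)%:~R).
exists (X (2 * n).+2), (if m == 0%N then X 1%N else 0); split.
- rewrite /X subnn binz0 mul1r mulf_neq0 ?signr_eq0 //.
  by apply/prodf_neq0 => t _; rewrite (intr_eq0_char0 hK); lia.
- move=> hw; case: eqP => // m0; rewrite /X.
  (* Here [0 <= wu + n <= 2n], so the binomial of lower index [2n+1] vanishes. *)
  have /eqP -> : binz K (wu + m%:Z + n%:Z) ((2 * n).+2 - 1) == 0.
    by rewrite (binz_eq0 hK); lia.
  by rewrite mul0r.
- by move=> h; case/eqP: hk'.
move=> b Gb hpos hmid.
have h1 : G (\sum_(1 <= j < (2 * n).+3) X j *: Y u (- (j + m)%N%:Z) b).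
  have e (j : nat) : binz K (wu + m%:Z + n%:Z) ((2 * n).+2 - j)
      *: Y (iter m (Lop (-1)) u) (- j%:Z) b = X j *: Y u (- (j + m)%N%:Z) b.
    by rewrite iter_Lm1_mode scalerA PoszD opprD.
  under eq_bigr => j _ do rewrite -e.
  apply: circ_reduction (homog_iter_Lm1 m hu) _ => j hj.
  (* For [j >= m] this is a nonnegative mode of [u]; for [0 <= j < m] the falling factorial contains
     the factor zero. *)
  rewrite iter_Lm1_mode; have [mj|jm] := lerP m%:Z j.
    by apply/(subspaceZ hG)/hpos; lia.
  case: j hj jm => // j _; rewrite ltz_nat => jm.
  rewrite (bigD1 (Ordinal jm)) //= subrr mul0r mulr0 scale0r.
  exact: subspace0 hG.
rewrite big_nat_recr //= -hm big_ltn in h1; last by lia.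
rewrite addrC; apply: (subspaceBl hG _ h1); rewrite opprD addrACA subrr addr0.
rewrite addrAC; apply: (subspaceD hG); last first.
  apply: (subspace_sum_nat hG) => i hi.
  by apply/(subspaceZ hG)/hmid; lia.
case: eqP => [->|m0]; first by rewrite subrr; apply: subspace0 hG.
by rewrite scale0r subr0; apply/(subspaceZ hG)/hmid; lia.
Qed.
End Reduction.

(** * Weights, derivatives and sorted forms of words *)

Section Words.
Variables (K : fieldType) (hK : [pchar K] =i pred0) (V : VOA K).
Variables (u : V) (wu : int) (hu : homog wu u).
Local Notation Y := (@vY K V).
Local Notation one := (vone V).
Local Notation W ks := (uword u ks one).

Lemma homog_uword ks : exists z, homog z (W ks).
Proof.
elim: ks => [|k ks [z hz]]; first by exists 0; apply: homog_one.
by exists (wu + z + k%:Z - 1); rewrite -{1}[k%:Z]opprK; apply: homog_mode.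
Qed.

(** Leibniz rule: the commutator of [L(-1)] with [u_{-k}] is [k u_{-k-1}], and [L(-1)] kills the
    vacuum. *)
Lemma Lm1_uword ks :
  Lop (-1) (W ks) =
  \sum_(j < size ks) (nth 0%N ks j)%:R *: W (set_nth 0%N ks j (nth 0%N ks j).+1).
Proof.
elim: ks => [|k ks IH]; first by rewrite big_ord0 Lm1_one.
rewrite /= Lm1_mode IH vYr_sum big_ord_recl addrC /=; congr (_ + _).
  rewrite mulrNz scaleNr opprK; congr (_ *: Y u _ _); lia.
by apply: eq_bigr => i _; rewrite vYrZ.
Qed.

Lemma uword_nseq1_cat s ks : W (nseq s 1%N ++ ks) = iter s (Y u (-1)) (W ks).
Proof. by elim: s => //= s ->. Qed.

Lemma homog_pow s : homog (s%:Z * wu) (iter s (Y u (-1)) one).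
Proof.
elim: s => [|s IH]; first by rewrite mul0r; apply: homog_one.
have -> : s.+1%:Z * wu = wu + s%:Z * wu - (-1) - 1 by lia.
exact: homog_mode.
Qed.

Lemma pword_uword t :
  pword u t = W (rev (flatten [seq nseq p.2 p.1 | p <- zip (iota 1 (size t)) t])).
Proof.
have key (z : seq (nat * nat)) l :
    foldl (fun x p => iter p.2 (Y u (- p.1%:Z)) x) (W l) z =
    W (rev (flatten [seq nseq p.2 p.1 | p <- z]) ++ l).
  elim: z l => [|[a b] z IH] l //=.
  rewrite rev_cat -catA -IH rev_nseq; congr foldl.
  by elim: b => //= b ->.
by rewrite /pword (key _ [::]) cats0.
Qed.

(** The exponents are the multiplicities of the letters [1, ..., N]; position 0 of the tuple counts
    the letter 1. *)
Lemma pword_sorted N ks : all (fun k => 0 < k <= N)%N ks -> (0 < N)%N ->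
  exists2 t : N.-tuple nat, nth 0%N t 0 = count_mem 1%N ks &
    exists2 ks', perm_eq ks ks' & pword u t = W ks'.
Proof.
move=> hks N0; have ht : size [seq count_mem i ks | i <- iota 1 N] == N.
  by rewrite size_map size_iota.
exists (Tuple ht) => /=; first by rewrite (nth_map 0%N) ?size_iota // nth_iota.
eexists; last exact: pword_uword.
rewrite perm_sym perm_rev /= (eqP ht).
have -> : zip (iota 1 N) [seq count_mem i ks | i <- iota 1 N]
   = [seq (i, count_mem i ks) | i <- iota 1 N].
  by elim: (iota 1 N) => //= i s ->.
rewrite -map_comp; apply/allP => x _ /=.
rewrite count_flatten -map_comp sumnE big_map.
under eq_bigr => i _ do rewrite /= count_nseq /=.
have [hx|hx] := boolP (x \in iota 1 N).
  rewrite (bigD1_seq x) ?iota_uniq //= eqxx mul1n big1 ?addn0 // => i /negPf ->.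
  by rewrite mul0n.
rewrite big1_seq; last first.
  by move=> i /andP [_ hi]; case: eqP hi hx => [-> ->|]; rewrite ?mul0n.
rewrite eq_sym -leqn0 leqNgt -has_count has_pred1; apply/negP => /(allP hks) h.
by move: hx; rewrite mem_iota; lia.
Qed.
End Words.

Lemma perm_set_nth (x0 y : nat) ks j : (j < size ks)%N ->
  perm_eq (nth x0 ks j :: set_nth x0 ks j y) (y :: ks).
Proof.
elim: ks j => // k ks IH [|j] hj /=; first by rewrite (perm_catCA [:: k] [:: y]).
rewrite (perm_catCA [:: nth x0 ks j] [:: k]) perm_sym (perm_catCA [:: y] [:: k]).
by rewrite /= perm_cons perm_sym; apply: IH.
Qed.

Lemma count1_lt_size v : (size v < sumn v)%N -> (count_mem 1%N v < size v)%N.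
Proof.
move=> hv; rewrite ltn_neqAle count_size andbT; apply/negP; rewrite -all_count.
by move/all_pred1P => hv1; move: hv; rewrite {2}hv1 sumn_nseq mul1n ltnn.
Qed.

(** * The induction placing every word in the generated subalgebra *)

Section Main.
Variables (K : fieldType) (hK : [pchar K] =i pred0) (V : VOA K).
Variables (n : nat) (hn : (0 < n)%N) (u : V) (wu : int) (hu : homog wu u).
Hypotheses (hwu : - (n%:Z) <= wu) (hperm : permutation_property u).
Local Notation Y := (@vY K V).
Local Notation one := (vone V).
Local Notation W ks := (uword u ks one).
Local Notation positive := (all (fun k => 0 < k)%N).

Definition gens (y : V) : Prop :=
  (exists t : (2 * n).-tuple nat,
     - (n%:Z) <= (nth 0%N t 0)%:Z * wu <= n%:Z /\ y = pword u t)
  \/ (exists j : nat, (0 < j)%N /\ y = iter j (Y u (-1)) one).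

Local Notation G := (genA n gens).

Let hG : subspace G := subspace_G n gens.

Lemma pow_in_G s : (0 < s)%N -> G (iter s (Y u (-1)) one).
Proof. by move=> s0; apply: gA_gen; right; exists s. Qed.

Lemma u_in_G : G u.
Proof. by have := @pow_in_G 1 isT; rewrite /= vY_creation. Qed.

(** * Words of length [r], all shorter ones being settled *)

Section FixedLength.
Variable r : nat.
Hypothesis shorter : forall ks, positive ks -> (size ks < r)%N -> G (W ks).

Lemma F_in_G x : (0 < r)%N -> Fspan u r.-1 one x -> G x.
Proof.
move=> r0; apply: (span_min hG) => _ [ks [h1 h2 ->]]; apply: shorter => //; lia.
Qed.

Lemma perm_in_G ks ks' : perm_eq ks ks' -> size ks = r -> G (W ks') -> G (W ks).
Proof.
move=> h hs; have [r0|r0] := posnP r.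
  rewrite r0 in hs; move: (perm_size h); rewrite hs.
  by rewrite (size0nil hs) => /esym/size0nil ->.
apply: (subspaceBr hG); apply: F_in_G => //; rewrite -hs.
by apply: uword_perm; rewrite // hs.
Qed.

Lemma nonneg_mode_in_G ks (j : int) :
  positive ks -> (size ks).+1 = r -> 0 <= j -> G (Y u j (W ks)).
Proof.
move=> hks hs hj; apply: F_in_G; first by rewrite -hs.
by rewrite -hs; apply: F_nonneg_mode => //; apply: word_in_F.
Qed.

(** Induction on the sum of the letters, a letter above [2n] being replaced by smaller ones. The
    bound on letters 1 survives because either the reduction creates no letter 1 or [c] is at least
    the length. *)
Lemma bounded_parts_suffice c :
  (0 < `|wu| <= n)%N \/ (r <= c)%N ->
  (forall ks, all (fun k => 0 < k <= 2 * n)%N ks -> size ks = r ->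
     (count_mem 1%N ks <= c)%N -> G (W ks)) ->
  forall ks, positive ks -> size ks = r -> (count_mem 1%N ks <= c)%N -> G (W ks).
Proof.
move=> hc hb ks; have [N] := ubnP (sumn ks); elim: N ks => // N IH ks hN hks hs hcnt.
have [hall|/allPn hall] := boolP (all (fun k => 0 < k <= 2 * n)%N ks); first exact: hb.
have {hall} [k kks hk] : exists2 k : nat, k \in ks & ~~ (0 < k <= 2 * n)%N by [].
have k0 := allP hks _ kks.
have {}hk : (2 * n < k)%N by lia.
have hp := perm_to_rem kks; apply: (perm_in_G hp hs) => /=.
have hN' : (k + sumn (rem k ks) <= N)%N.
  by have := perm_sumn hp => /= <-.
have hs' : (size (rem k ks)).+1 = r by rewrite -hs (perm_size hp).
have hks' : positive (rem k ks).
  by apply/allP => i /mem_rem; apply: (allP hks).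
have hcnt' : (count_mem 1%N (rem k ks) <= c)%N.
  by apply: leq_trans hcnt; rewrite (seq.permP hp) /= leq_addl.
have hlow j : (0 < j < k)%N -> (j = 1%N -> (r <= c)%N) -> G (Y u (- j%:Z) (W (rem k ks))).
  move=> hj h1; apply: (IH (j :: rem k ks)) => //=; first by lia.
  - by rewrite hks' andbT; lia.
  - have [j1|//] := eqVneq j 1%N.
    by apply: leq_trans (h1 j1); rewrite -hs' add1n ltnS count_size.
have [d [al [d0 h1 _ h2]]] := mode_reduction hK hn hu hwu u_in_G hk.
apply: (subspace_scale_inv hG d0).
rewrite -[_ *: _](addrK (al *: Y u (-1) (W (rem k ks)))); apply: (subspaceB hG).
  apply: h2 => [|j hj|j hj]; first by apply: shorter; rewrite -?hs'.
    exact: nonneg_mode_in_G.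
  by apply: hlow; lia.
case: hc => hc; first by rewrite h1 // scale0r; apply: (subspace0 hG).
by apply/(subspaceZ hG)/(hlow 1%N); lia.
Qed.

Lemma sorted_in_G ks : all (fun k => 0 < k <= 2 * n)%N ks -> size ks = r ->
  - n%:Z <= (count_mem 1%N ks)%:Z * wu <= n%:Z -> G (W ks).
Proof.
move=> h1 hs hc; have [|t ht [ks' hp hw]] := pword_sorted u h1; first by lia.
apply: (perm_in_G hp hs); rewrite -hw; apply: gA_gen; left; exists t; split=> //.
by rewrite ht.
Qed.

(* Replacing [u_{-1}] by [u_{-2n}] and applying [L(-1)] gives back [u_{-1}], through
   the reduction of [u_{-2n-1}], and otherwise only words with fewer [u_{-1}]. *)
Lemma large_weight_step c : ~~ (0 < `|wu| <= n)%N ->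
  (forall ks, all (fun k => 0 < k <= 2 * n)%N ks -> size ks = r ->
     (count_mem 1%N ks <= c)%N -> G (W ks)) ->
  forall ks, all (fun k => 0 < k <= 2 * n)%N ks -> size ks = r ->
     count_mem 1%N ks = c.+1 -> G (W ks).
Proof.
move=> hw hb ks hks hs hc.
have h1 : 1%N \in ks by rewrite -has_pred1 has_count hc.
have hp := perm_to_rem h1; apply: (perm_in_G hp hs).
set M := rem 1%N ks in hp *.
have hM : all (fun k => 0 < k <= 2 * n)%N M.
  by apply/allP => i /mem_rem; apply: (allP hks).
have hcM : count_mem 1%N M = c.
  by have := seq.permP hp (pred1 1%N); rewrite hc /= add1n => -[->].
have hsM : (size M).+1 = r by rewrite -hs (perm_size hp).
have hpM : positive M by apply: sub_all hM => i /andP [].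
pose L := (2 * n)%N :: M.
have hLb : all (fun k => 0 < k <= 2 * n)%N L by rewrite /= hM; lia.
have GL : G (W L) by apply: hb => //=; rewrite hcM; lia.
(* A word is homogeneous, so [L(0)] multiplies it by a scalar, and [L(-1) + L(0)] lands in
   [O_n(V)]. *)
have GLm1 : G (Lop (-1) (W L)).
  have [z hz] := homog_uword hu L.
  rewrite -[Lop _ _](addrK (z%:~R *: W L)); apply: (subspaceB hG).
    by apply/On_genA/sp_gen; left; exists (W L); rewrite hz.
  exact: (subspaceZ hG).
have [d [al [d0 _ al0 h2]]] := mode_reduction hK hn hu hwu u_in_G (ltnSn (2 * n)).
have {}h2 : G (d *: W ((2 * n).+1 :: M) + al *: W (1%N :: M)).
  apply: h2 => [|j hj|j hj]; first by apply: shorter; rewrite -?hsM.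
    exact: nonneg_mode_in_G.
  by apply: (hb (j :: M)); rewrite //= ?hM ?hcM; lia.
(* A raised letter [2n] becomes [2n+1] and is traded for the letter 1 by [h2]. Any other raised
   letter stays within [2n] and is at least 2. *)
have h3 (j : 'I_(size L)) :
    G (d *: W (set_nth 0%N L j (nth 0%N L j).+1)
       + (if nth 0%N L j == (2 * n)%N then al else 0) *: W (1%N :: M)).
  have hset := perm_set_nth 0%N (nth 0%N L j).+1 (ltn_ord j).
  have hj : (0 < nth 0%N L j <= 2 * n)%N := allP hLb _ (mem_nth 0%N (ltn_ord j)).
  have hsz : size (set_nth 0%N L j (nth 0%N L j).+1) = r.
    by have := perm_size hset => /= -[->].
  case: eqP => [ej|nj].
    apply: (subspaceBr hG _ h2); rewrite opprD addrACA subrr addr0 -scalerBr.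
    apply/(subspaceZ hG)/F_in_G; first by rewrite -hsM.
    rewrite -{1}hsz; apply: uword_perm; rewrite ?hsz -?hsM // -(perm_cons (2 * n)%N).
    rewrite -{1}ej; apply: (perm_trans hset); rewrite ej.
    by rewrite (perm_catCA [:: (2 * n).+1] [:: (2 * n)%N]).
  rewrite scale0r addr0; apply/(subspaceZ hG)/hb => //.
    have : all (fun k => 0 < k <= 2 * n)%N
        (nth 0%N L j :: set_nth 0%N L j (nth 0%N L j).+1).
      rewrite (perm_all _ hset); apply/andP; split; last exact: hLb.
      by case/andP: hj => _ hj; apply/andP; split; rewrite // ltn_neqAle hj andbT; apply/eqP.
    by case/andP.
  have hcL : count_mem 1%N L = c by rewrite /= hcM; case: eqP; lia.
  apply: (@leq_trans (count_mem 1%N (nth 0%N L j :: set_nth 0%N L j (nth 0%N L j).+1))).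
    exact: leq_addl.
  rewrite (seq.permP hset) -[count _ _]/(((nth 0%N L j).+1 == 1%N) + count_mem 1%N L)%N.
  by rewrite hcL; case: eqP; lia.
(* Weighting [h3] by the Leibniz coefficients makes the first summands add up to [d] times [L(-1)]
   of the word [L], already in [G]. *)
have h4 : G ((\sum_(j < size L) (nth 0%N L j)%:R *
   (if nth 0%N L j == (2 * n)%N then al else 0)) *: W (1%N :: M)).
  have h : G (\sum_(j < size L) (nth 0%N L j)%:R *: (
    d *: W (set_nth 0%N L j (nth 0%N L j).+1)
       + (if nth 0%N L j == (2 * n)%N then al else 0) *: W (1%N :: M))).
    by apply: (subspace_sum hG) => j _; apply: (subspaceZ hG).
  apply: (subspaceBl hG _ h); rewrite scaler_suml -sumrB.
  have e (x y : K) (v w : V) : x *: (d *: v + y *: w) - (x * y) *: w = d *: (x *: v).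
    by rewrite scalerDr [x *: (y *: w)]scalerA addrK !scalerA mulrC.
  under eq_bigr => j _ do rewrite e.
  by rewrite -scaler_sumr -Lm1_uword; apply: (subspaceZ hG).
apply: (subspace_scale_inv hG _ h4).
(* The contributions have no cancellation: each letter [2n] gives [2n * al], and the head of [L] is
   one. *)
have -> : \sum_(j < size L) (nth 0%N L j)%:R *
   (if nth 0%N L j == (2 * n)%N then al else 0) =
   (2 * n * count_mem (2 * n)%N L)%:R * al.
  rewrite -(big_mkord xpredT (fun j => (nth 0%N L j)%:R *
     (if nth 0%N L j == (2 * n)%N then al else 0))).
  rewrite -(big_nth 0%N xpredT (fun i => i%:R * (if i == (2 * n)%N then al else 0))).
  elim: (L) => [|i l IH]; first by rewrite big_nil muln0 mul0r.
  rewrite big_cons IH /= mulnDr natrD mulrDl; congr (_ + _).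
  by case: eqP => [->|_]; rewrite ?muln1 ?muln0 ?mulr0 ?mul0r.
rewrite mulf_neq0 ?al0 // (natr_neq0 hK) //= eqxx; lia.
Qed.

(** In the product of [a = u_{-1}^{c+1} 1] with the word [M] of the letters other than 1, the weight
    of [a] makes the coefficient of [a_{-1}] nonzero, and that term is the desired word up to
    shorter ones. *)
Lemma small_weight_step c : (0 < `|wu| <= n)%N -> (n < `|(c.+1%:Z * wu)%R|)%N ->
  (forall ks, all (fun k => 0 < k <= 2 * n)%N ks -> size ks = r ->
     (count_mem 1%N ks <= c)%N -> G (W ks)) ->
  forall ks, all (fun k => 0 < k <= 2 * n)%N ks -> size ks = r ->
     count_mem 1%N ks = c.+1 -> G (W ks).
Proof.
move=> hw hcw hb ks hks hs hc.
(* The modes [a_{-j}] may produce letters above [2n], so the hypothesis is first extended to all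
   positive words. *)
have {}hb := bounded_parts_suffice (or_introl hw) hb.
pose M : seq nat := [seq k <- ks | k != 1%N].
have hp : perm_eq ks (nseq c.+1 1%N ++ M).
  rewrite -hc -(perm_filterC (pred1 1%N)) perm_cat2r.
  by rewrite -size_filter; have /all_pred1P <- := filter_all (pred1 1%N) ks.
apply: (perm_in_G hp hs).
have hM : positive M.
  by apply/allP => i; rewrite mem_filter => /andP [_ /(allP hks)] /andP [].
have hcM : count_mem 1%N M = 0%N.
  by rewrite count_filter; apply/eqP; rewrite -leqn0 leqNgt -has_count;
     apply/hasPn => i _ /=; case: eqP.
have hsM : (size M + c.+1 = r)%N.
  by rewrite -hs (perm_size hp) size_cat size_nseq addnC.
have hF x : Fspan u (size M + c.+1).-1 one x -> G x.
  by rewrite hsM; apply: F_in_G; lia.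
set a := iter c.+1 (Y u (-1)) one.
have := @star_reduction K V n gens a (W M) _ (homog_pow hu c.+1) (pow_in_G (ltn0Sn c)).
have GM : G (W M) by apply: shorter => //; lia.
move=> /(_ GM) h; have {h} : G (\sum_(1 <= j < (2 * n).+2)
    star_coef K n (c.+1%:Z * wu) j *: Y a (- j%:Z) (W M)).
  by apply: h => j hj; apply: hF; apply: pow_nonneg_mode_F => //; apply: word_in_F.
rewrite big_ltn // => h.
have hlow j : (1 < j)%N -> G (Y a (- j%:Z) (W M)).
  move=> hj; apply: (span_min hG) (pow_neg_mode hK hperm c.+1 hM (ltnW hj)).
  move=> _ [[_ /hF //]|[v [hv1 hv2 hv3 ->]]]; apply: hb.
  - by rewrite all_cat hv2.
  - by rewrite size_cat hv1 addnC.
  (* The [c + 1] letters of [v] have sum [j + c], which exceeds [c + 1] as [j > 1]; so not all of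
     them are 1. *)
  by rewrite count_cat hcM addn0 -ltnS -hv1; apply: count1_lt_size; lia.
have c0 : star_coef K n (c.+1%:Z * wu) 1 != 0.
  by rewrite (star_coef1_eq0 hK); lia.
have {}h : G (Y a (-1) (W M)).
  apply: (subspace_scale_inv hG c0); rewrite addrC in h.
  apply: (subspaceBl hG (x := _ + _) _ h); rewrite addrK.
  apply: (subspace_sum_nat hG) => j /andP [hj _].
  exact/(subspaceZ hG)/hlow.
rewrite uword_nseq1_cat; apply: (subspaceBl hG _ h).
exact/hF/pow_mode1.
Qed.
End FixedLength.

(** Outer induction on the length, inner induction on the number of letters 1. *)
Lemma word_in_G ks : positive ks -> G (W ks).
Proof.
have [r] := ubnP (size ks); elim: r ks => // r IH ks hr hks.
have shorter l : positive l -> (size l < size ks)%N -> G (W l).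
  by move=> hl ls; apply: IH => //; apply: leq_trans ls _.
apply: (bounded_parts_suffice shorter (or_intror (leqnn _)) _ hks erefl (count_size _ _)).
have hind c l : all (fun k => 0 < k <= 2 * n)%N l -> size l = size ks ->
    (count_mem 1%N l <= c)%N -> G (W l).
  elim: c l => [|c IHc] l hl hs hc.
    apply: (sorted_in_G shorter) => //; move: hc; rewrite leqn0 => /eqP ->; lia.
  move: hc; rewrite leq_eqVlt ltnS => /orP [/eqP hc|]; last exact: IHc.
  (* Within the bound the sorted word is itself a generator; beyond it the size of [wu] decides
     which step lowers the number of letters 1. *)
  have [hcw|hcw] := leqP `|(c.+1%:Z * wu)%R|%N n.
    by apply: (sorted_in_G shorter) => //; rewrite hc; lia.
  have [hw|hw] := boolP (0 < `|wu| <= n)%N.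
    exact: (small_weight_step shorter hw hcw IHc).
  exact: (large_weight_step shorter hw IHc).
by move=> l hl hs; apply: hind.
Qed.
End Main.

Theorem theorem3p15 (K : fieldType) (hK : [pchar K] =i pred0) (V : VOA K)
    (n : nat) (hn : (0 < n)%N) (u : V) (wu : int) (hu : homog wu u)
    (hwu : - (n%:Z) <= wu)
    (hsub : forall (a b : V) (m : int), Vu u a -> Vu u b -> Vu u (vY a m b))
    (hperm : permutation_property u) :
  forall x : V,
    genA n (Vu u) x <->
    genA n (fun y : V =>
              (exists t : (2 * n).-tuple nat,
                  - (n%:Z) <= (nth 0%N t 0)%:Z * wu <= n%:Z /\ y = pword u t)
              \/ (exists j : nat, (0 < j)%N /\ y = iter j (vY u (-1)) (vone V))) x.
Proof.
have genA_min (S T : V -> Prop) :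
    (forall y, S y -> genA n T y) -> forall y, genA n S y -> genA n T y.
  move=> hST y; elim=> {y} [y /hST //||y z _ hy _ hz|a y _ hy|y z w _ hy _ hz hw|y z _ hy hz].
  - exact: gA_0.
  - exact: gA_add.
  - exact: gA_scale.
  - exact: gA_mul hw.
  - exact: gA_mod hz.
move=> x; split; apply: genA_min => {}x.
  apply: span_min; first exact: subspace_G.
  by move=> _ [ks [hks ->]]; apply: word_in_G.
(* Conversely, each proposed generator is a single word with positive letters. *)
move=> hx; apply: gA_gen; apply: sp_gen; case: hx => [[t [_ ->]]|[j [_ ->]]].
  rewrite pword_uword; eexists; split; last by [].
  apply/allP => i; rewrite mem_rev => /flattenP [_ /mapP [[a b] hab ->]] /=.
  rewrite mem_nseq => /andP [_ /eqP ->].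
  have := map_f fst hab; rewrite -/(unzip1 _) unzip1_zip ?size_iota //.
  by rewrite mem_iota => /andP [].
exists (nseq j 1%N); split; first by rewrite all_nseq orbT.
by rewrite -[nseq _ _]cats0 uword_nseq1_cat.
Qed.
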